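(* Let $X$ be an integral scheme and let $\mathscr{F}$ be the class of locally torsion-free quasi-coherent sheaves on $X$. Then $\mathscr{F}$ is closed under arbitrary direct products in $\mathfrak{Qcoh}(X)$. In particular, $\mathscr{F}$ induces a torsion theory of finite type in $\mathfrak{Qcoh}(X)$, i.e. $\mathscr{F}$ is the torsion-free class of a torsion theory of finite type in $\mathfrak{Qcoh}(X)$.
   Context: $\mathfrak{Qcoh}(X)$ is the category of quasi-coherent sheaves on $X$ (a Grothendieck category, so it has direct products; these are in general not the products of $\mathcal{O}_X$-modules). A quasi-coherent sheaf $\mathcal{F}$ on $X$ is locally torsion-free if $\mathcal{F}(U)$ is a torsion-free $\mathcal{O}_X(U)$-module for each (non-empty) affine open subset $U\subseteq X$. A torsion theory for a category $\mathcal{C}$ is a pair $(\mathscr{T},\mathscr{F})$ of classes of objects of $\mathcal{C}$ such that: (1) $\mathrm{Hom}(T,F)=0$ for all $T\in\mathscr{T}$, $F\in\mathscr{F}$; (2) if $\mathrm{Hom}(C,F)=0$ for all $F\in\mathscr{F}$, then $C\in\mathscr{T}$; (3) if $\mathrm{Hom}(T,C)=0$ for all $T\in\mathscr{T}$, then $C\in\mathscr{F}$. Then $\mathscr{T}$ is called a torsion class and $\mathscr{F}$ a torsion-free class. The torsion theory is of finite type if its torsion-free class is closed under direct limits. *)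

(* Defs.v *)
From HB Require Import structures.
From mathcomp Require Import all_boot all_algebra.
From mathcomp Require Import all_classical topology.

Set Implicit Arguments.
Unset Strict Implicit.
Unset Printing Implicit Defensive.

Import GRing.Theory.
Local Open Scope classical_set_scope.
Local Open Scope ring_scope.

(* Rings of sections may be trivial (the sections over the empty set always    *)
(* are), whence the use of comPzRingType throughout.                           *)

Record prime_ideal (A : comPzRingType) (P : set A) : Prop := PrimeIdeal {
  prime_ideal0 : P 0;
  prime_idealD : forall a b, P a -> P b -> P (a + b);
  prime_idealM : forall a b, P b -> P (a * b);
  prime_ideal1 : ~ P 1;
  prime_idealP : forall a b, P (a * b) -> P a \/ P b }.

Record spec (A : comPzRingType) := Spec {
  spec_set :> set A;
  spec_prime : prime_ideal spec_set }.

Definition zero_locus (A : comPzRingType) (E : set A) : set (spec A) :=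
  [set P : spec A | E `<=` P].

Definition basic_open (A : comPzRingType) (f : A) : set (spec A) :=
  [set P : spec A | ~ spec_set P f].

Section ZariskiTopology.
Variable A : comPzRingType.

HB.instance Definition _ := gen_eqMixin (spec A).
HB.instance Definition _ := gen_choiceMixin (spec A).

Definition zariski_open (W : set (spec A)) :=
  exists E : set A, W = ~` zero_locus E.

Lemma zariski_openT : zariski_open setT.
Proof.
exists [set 1]; apply/esym; rewrite -subTset => P _ /(_ 1 erefl).
exact: (prime_ideal1 (spec_prime P)).
Qed.

Lemma zariski_openI : setI_closed zariski_open.
Proof.
move=> _ _ [E ->] [F ->]; exists [set a * b | a in E & b in F].
rewrite -setCU; congr (~` _); apply/seteqP; split=> P /=.
  case=> [EP|FP] _ [a Ea [b Fb <-]].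
    by rewrite mulrC; apply: prime_idealM (spec_prime P) _ _ (EP a Ea).
  exact: prime_idealM (spec_prime P) _ _ (FP b Fb).
move=> EFP; have [EP|/existsNP[a /not_implyP[Ea Pa]]] := pselect (E `<=` P).
  by left.
right=> b Fb; have := EFP (a * b); case/(_ _)/(prime_idealP (spec_prime P)) => //.
by exists a => //; exists b.
Qed.

Lemma zariski_open_bigU (I : Type) (W : I -> set (spec A)) :
  (forall i, zariski_open (W i)) -> zariski_open (\bigcup_i W i).
Proof.
move=> Wop; exists (\bigcup_i projT1 (cid (Wop i))).
have WE i : W i = ~` zero_locus (projT1 (cid (Wop i))) := projT2 (cid (Wop i)).
apply/seteqP; split=> P.
  by move=> [i _]; rewrite WE => PE PU; apply: PE => a Ea; apply: PU; exists i.
move=> PU; apply: contrapT => PW; apply: PU => a [i _ Ea].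
by apply: contrapT => Pa; apply: PW; exists i => //; rewrite WE => /(_ a Ea).
Qed.

HB.instance Definition _ := isOpenTopological.Build (spec A)
  zariski_openT zariski_openI zariski_open_bigU.

End ZariskiTopology.

(* [iota] exhibits [B] as the localization of the ring [A] at [f].            *)
Definition is_localization (A B : comPzRingType) (f : A) (iota : A -> B) :=
  [/\ exists v, iota f * v = 1,
      forall b, exists n a, iota f ^+ n * b = iota a
    & forall a, iota a = 0 -> exists n, f ^+ n * a = 0].

(* [mu] exhibits the [B]-module [N] as the localization of the [A]-module [M] *)
(* at [f], where [A] acts on [N] through [alpha].                             *)
Definition is_module_localization (A B : comPzRingType) (f : A)
    (alpha : A -> B) (M : lmodType A) (N : lmodType B) (mu : M -> N) :=
  [/\ bijective (fun y : N => alpha f *: y),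
      forall y, exists n x, alpha f ^+ n *: y = mu x
    & forall x, mu x = 0 -> exists n, f ^+ n *: x = 0].

Record opens (X : topologicalType) := Opens {
  opens_set :> set X;
  opens_open : open opens_set }.

Definition opensI (X : topologicalType) (U V : opens X) : opens X :=
  Opens (openI (opens_open U) (opens_open V)).

Record is_sheaf (X : topologicalType) (F : opens X -> Type)
    (r : forall U V : opens X, U `<=` V -> F V -> F U) : Prop := IsSheaf {
  sheaf_id : forall (U : opens X) (UU : U `<=` U) s, r U U UU s = s;
  sheaf_comp : forall (U V W : opens X)
    (UV : U `<=` V) (VW : V `<=` W) (UW : U `<=` W) s,
    r U V UV (r V W VW s) = r U W UW s;
  sheaf_glue : forall (I : Type) (V : opens X) (U : I -> opens X)
    (UV : forall i, U i `<=` V), V `<=` \bigcup_i U i ->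
    forall s : (forall i, F (U i)),
    (forall i j, r (opensI (U i) (U j)) (U i) (@subIsetl _ _ _) (s i) =
                 r (opensI (U i) (U j)) (U j) (@subIsetr _ _ _) (s j)) ->
    exists! t : F V, forall i, r (U i) V (UV i) t = s i }.

Record ringedSpace := RingedSpace {
  space :> topologicalType;
  sec : opens space -> comPzRingType;
  res : forall U V : opens space, U `<=` V -> {rmorphism sec V -> sec U};
  sec_sheaf : is_sheaf (fun U V UV => res UV : sec V -> sec U) }.

Arguments sec {r} U.
Arguments res {r U V} UV.

(* An isomorphism of ringed spaces between Spec A and the open subspace U of  *)
(* X: a homeomorphism [chart_pt] of Spec A onto U, together with a ring       *)
(* morphism from A to the sections over U which identifies the sections over  *)
(* the image of each D(f) with A_f. The structure sheaf of Spec A is the      *)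
(* sheaf determined by having sections A_f over the basic open sets D(f).     *)
Record affineChart (X : ringedSpace) (U : opens X) := AffineChart {
  chart_ring : comPzRingType;
  chart_pt : spec chart_ring -> X;
  chart_inj : injective chart_pt;
  chart_continuous : continuous chart_pt;
  chart_open : forall W, open W -> open (chart_pt @` W);
  chart_range : range chart_pt = U;
  chart_sec : {rmorphism chart_ring -> sec U};
  chart_loc : forall (f : chart_ring) (W : opens X) (WU : W `<=` U),
    (W : set X) = chart_pt @` basic_open f ->
    is_localization f (fun a => res WU (chart_sec a)) }.

Arguments chart_pt {X U} a _.

Definition affine_open (X : ringedSpace) (U : opens X) :=
  inhabited (affineChart U).

Record scheme := Scheme {
  scheme_space :> ringedSpace;
  scheme_affine : forall x : scheme_space,
    exists2 U : opens scheme_space, opens_set U x & affine_open U }.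

Definition integral_domain (A : comPzRingType) :=
  (1 : A) <> 0 /\ forall a b : A, a * b = 0 -> a = 0 \/ b = 0.

Definition integral_scheme (X : scheme) :=
  [set: X] !=set0 /\
  forall U : opens X, U !=set0 -> integral_domain (sec U).

Record omodule (X : ringedSpace) := OModule {
  msec :> forall U : opens X, lmodType (sec U);
  mres : forall (U V : opens X) (UV : U `<=` V),
    {linear msec V -> msec U | res UV \; *:%R};
  msec_sheaf : is_sheaf (fun U V UV => mres UV : msec V -> msec U) }.

Arguments mres {X} o {U V} UV.

(* The restriction of F to U is the sheaf associated with the module M over   *)
(* the ring A of the chart, whose sections over D(f) are M_f.                 *)
Definition associated_on (X : ringedSpace) (F : omodule X) (U : opens X)
    (c : affineChart U) (M : lmodType (chart_ring c)) :=
  exists mu : {linear M -> F U | chart_sec c \; *:%R},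
  forall (f : chart_ring c) (W : opens X) (WU : W `<=` U),
    (W : set X) = chart_pt c @` basic_open f ->
    is_module_localization f (fun a => res WU (chart_sec c a))
      (fun x => mres F WU (mu x)).

Definition quasi_coherent (X : scheme) (F : omodule X) :=
  forall x : X, exists U : opens X, opens_set U x /\
  exists (c : affineChart U) (M : lmodType (chart_ring c)),
    associated_on F M.

Record qcoh (X : scheme) := QCoh {
  qcoh_mod :> omodule X;
  qcohP : quasi_coherent qcoh_mod }.

Record ohom (X : ringedSpace) (F G : omodule X) := OHom {
  ohom_fun :> forall U : opens X, {linear F U -> G U};
  ohom_nat : forall (U V : opens X) (UV : U `<=` V) s,
    mres G UV (ohom_fun V s) = ohom_fun U (mres F UV s) }.

Definition ohom_eq (X : ringedSpace) (F G : omodule X) (u v : ohom F G) :=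
  forall (U : opens X) (s : F U), u U s = v U s.

Definition ohom_zero (X : ringedSpace) (F G : omodule X) :=
  forall (u : ohom F G) (U : opens X) (s : F U), u U s = 0.

Definition locally_torsion_free (X : scheme) (F : qcoh X) :=
  forall U : opens X, affine_open U -> U !=set0 ->
  forall (a : sec U) (s : F U), a *: s = 0 -> a = 0 \/ s = 0.

(* The universal properties below quantify over quasi-coherent sheaves only:  *)
(* products and direct limits are those of Qcoh(X).                           *)

Section QCohCategory.
Variable X : scheme.

Definition is_product (I : Type) (F : I -> qcoh X) (P : qcoh X)
    (p : forall i, ohom P (F i)) :=
  forall (Q : qcoh X) (q : forall i, ohom Q (F i)),
  exists2 u : ohom Q P, forall i U s, p i U (u U s) = q i U s
    & forall v : ohom Q P, (forall i U s, p i U (v U s) = q i U s) ->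
      ohom_eq v u.

Definition closed_under_products (C : qcoh X -> Prop) :=
  forall (I : Type) (F : I -> qcoh X) (P : qcoh X) (p : forall i, ohom P (F i)),
  (forall i, C (F i)) -> is_product p -> C P.

Record directed_preorder (I : Type) (le : I -> I -> Prop) : Prop := Directed {
  directed_inhabited : inhabited I;
  directed_refl : forall i, le i i;
  directed_trans : forall i j k, le i j -> le j k -> le i k;
  directed_ub : forall i j, exists2 k, le i k & le j k }.

Record is_direct_system (I : Type) (le : I -> I -> Prop) (F : I -> qcoh X)
    (f : forall i j, le i j -> ohom (F i) (F j)) : Prop := IsDirectSystem {
  direct_system_id : forall i (ii : le i i) U s, f i i ii U s = s;
  direct_system_comp : forall i j k (ij : le i j) (jk : le j k) (ik : le i k)
    U s, f j k jk U (f i j ij U s) = f i k ik U s }.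

Definition is_cocone (I : Type) (le : I -> I -> Prop) (F : I -> qcoh X)
    (f : forall i j, le i j -> ohom (F i) (F j))
    (L : qcoh X) (l : forall i, ohom (F i) L) :=
  forall i j (ij : le i j) U s, l j U (f i j ij U s) = l i U s.

Definition is_direct_limit (I : Type) (le : I -> I -> Prop) (F : I -> qcoh X)
    (f : forall i j, le i j -> ohom (F i) (F j))
    (L : qcoh X) (l : forall i, ohom (F i) L) :=
  is_cocone f l /\
  forall (Q : qcoh X) (q : forall i, ohom (F i) Q), is_cocone f q ->
  exists2 u : ohom L Q, forall i U s, u U (l i U s) = q i U s
    & forall v : ohom L Q, (forall i U s, v U (l i U s) = q i U s) ->
      ohom_eq v u.

Definition closed_under_direct_limits (C : qcoh X -> Prop) :=
  forall (I : Type) (le : I -> I -> Prop) (F : I -> qcoh X)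
    (f : forall i j, le i j -> ohom (F i) (F j))
    (L : qcoh X) (l : forall i, ohom (F i) L),
  directed_preorder le -> is_direct_system f -> (forall i, C (F i)) ->
  is_direct_limit f l -> C L.

Record torsion_theory (T F : qcoh X -> Prop) : Prop := TorsionTheory {
  torsion_hom0 : forall A B : qcoh X, T A -> F B -> ohom_zero A B;
  torsion_classP : forall C : qcoh X,
    (forall B : qcoh X, F B -> ohom_zero C B) -> T C;
  torsion_free_classP : forall C : qcoh X,
    (forall A : qcoh X, T A -> ohom_zero A C) -> F C }.

Definition torsion_theory_of_finite_type (T F : qcoh X -> Prop) :=
  torsion_theory T F /\ closed_under_direct_limits F.

End QCohCategory.

(* Main.v *)
From HB Require Import structures.
From mathcomp Require Import all_boot all_algebra.
From mathcomp Require Import all_classical topology.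
Require Import Defs.


(** On an integral scheme X any two nonempty open sets meet, and a nonzero
    function is invertible on some nonempty open set. Hence a quasi-coherent
    sheaf F is locally torsion-free exactly when a section that vanishes on
    some nonempty open set is zero ([generically_separatedP]): a torsion
    section dies where its annihilator becomes invertible, and on an affine
    chart a section vanishing on a nonempty D(g) is killed by a power of g.

    For any quasi-coherent F, the sections that vanish on some nonempty open
    set form a quasi-coherent subsheaf tF ([torsion]). Every morphism from tF
    to a torsion-free sheaf is zero, and F is torsion-free as soon as the
    inclusion of tF in F is zero. So the torsion-free sheaves are the
    torsion-free class of the theory whose torsion class consists of the
    sheaves without nonzero morphism to a torsion-free one
    ([torsion_free_theory]). A torsion-free class is closed under products:
    morphisms from a torsion object to a product vanish because their
    components do ([torsion_free_class_products]). In this way products and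
    quotients of quasi-coherent sheaves never have to be constructed.

    For direct limits, let L with the maps l_i be the limit of a directed
    system (F_i, f_ij) of torsion-free sheaves. Two facts about L, both
    consequences of its universal property, are enough.
    - Every section of L is locally of the form l_i(y) ([direct_limit_local]).
      The sections of this form make up a subsheaf of L through which all the
      l_i factor; if it is quasi-coherent, it must be all of L. Its
      quasi-coherence rests on the fact that a section of a torsion-free
      sheaf over D(f) extends, after multiplication by a power of f, to the
      whole affine open set ([sections_extend]).
    - If l_i(y) = 0 over a nonempty open set, then f_ij(y) vanishes on some
      nonempty open set, for some j. Indeed the germs of sections of the F_i
      at the generic point have a direct limit, which embeds in a reduced
      product V; the constant sheaf with value V is quasi-coherent, and the
      maps from the F_i to it form a cocone, hence factor through L; see
      [germ_map_eq0].
    If now a section s of L vanishes on a nonempty open set, write s = l_i(y)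
    locally; then f_ij(y) vanishes generically for some j, so f_ij(y) = 0 as
    F_j is torsion-free, and s = l_j(f_ij(y)) = 0
    ([direct_limit_separated]). *)

Set Implicit Arguments.
Unset Strict Implicit.
Unset Printing Implicit Defensive.

Import GRing.Theory.
Local Open Scope classical_set_scope.
Local Open Scope ring_scope.

(** * Sections of sheaves *)

Section Sheaves.
Variable X : topologicalType.

Lemma sheaf_sep (F : opens X -> Type)
    (r : forall U V : opens X, U `<=` V -> F V -> F U) :
  is_sheaf r -> forall (U : opens X) (s t : F U),
  (forall x, opens_set U x -> exists (W : opens X) (WU : W `<=` U),
     opens_set W x /\ r W U WU s = r W U WU t) -> s = t.
Proof.
move=> rF U s t st.
pose I := {W : opens X | exists WU : W `<=` U, r W U WU s = r W U WU t}.
have IU (i : I) : sval i `<=` U by case: i => W [].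
have cov : U `<=` \bigcup_i (sval (i : I)).
  by move=> x /st[W [WU [Wx Wst]]]; exists (exist _ W (ex_intro _ WU Wst)).
have [|t0 [_ t0E]] := sheaf_glue rF IU cov (s := fun i => r _ _ (IU i) s).
  move=> i j; have IJ : opensI (sval i) (sval j) `<=` U by move=> x [/IU].
  by rewrite !(sheaf_comp rF _ _ IJ).
rewrite -(t0E s) //; apply: t0E => -[W [WU Wst]] /=.
by move: (IU _) => /= WU1; rewrite (Prop_irrelevance WU1 WU).
Qed.

Definition opensU (U V : opens X) : opens X :=
  Opens (openU (opens_open U) (opens_open V)).

Lemma sheaf_glue2 (F : opens X -> Type)
    (r : forall U V : opens X, U `<=` V -> F V -> F U) :
  is_sheaf r -> forall (U V1 V2 : opens X) (V1U : V1 `<=` U) (V2U : V2 `<=` U)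
    (s1 : F V1) (s2 : F V2), U `<=` V1 `|` V2 ->
  (forall (W : opens X) (W1 : W `<=` V1) (W2 : W `<=` V2),
    r W V1 W1 s1 = r W V2 W2 s2) ->
  exists s : F U, r V1 U V1U s = s1 /\ r V2 U V2U s = s2.
Proof.
move=> rF U V1 V2 V1U V2U s1 s2 cov s12; pose V b := if b then V1 else V2.
have VU b : V b `<=` U by case: b.
pose s b : F (V b) := if b as b0 return F (V b0) then s1 else s2.
have cV : U `<=` \bigcup_b (V b) by move=> x /cov[]; [exists true|exists false].
have [i j|t [tE _]] := sheaf_glue rF VU cV (s := s).
  move: (@subIsetl _ (V i) (V j)) (@subIsetr _ (V i) (V j)).
  case: i; case: j => /= A B.
  - by congr (r _ _ _ s1); apply: Prop_irrelevance.
  - exact: s12.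
  - by rewrite (s12 (opensI V2 V1) B A).
  - by congr (r _ _ _ s2); apply: Prop_irrelevance.
exists t; split.
  by rewrite (Prop_irrelevance V1U (VU true)); exact: tE true.
by rewrite (Prop_irrelevance V2U (VU false)); exact: tE false.
Qed.

End Sheaves.

Section Restriction.
Variables (X : ringedSpace).
Implicit Types (U V W : opens X) (F : omodule X).

Lemma res_comp U V W (UV : U `<=` V) (VW : V `<=` W) (UW : U `<=` W)
    (a : sec W) :
  res UV (res VW a) = res UW a.
Proof. exact: (sheaf_comp (sec_sheaf X)). Qed.

Lemma mres_id F U (UU : U `<=` U) (x : F U) :
  mres F UU x = x.
Proof. exact: (sheaf_id (msec_sheaf F)). Qed.

Lemma mres_comp F U V W (UV : U `<=` V) (VW : V `<=` W) (UW : U `<=` W)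
  (s : F W) : mres F UV (mres F VW s) = mres F UW s.
Proof. exact: (sheaf_comp (msec_sheaf F)). Qed.

Lemma mresZ F U V (UV : U `<=` V) (a : sec V) (s : F V) :
  mres F UV (a *: s) = res UV a *: mres F UV s.
Proof. exact: linearZ. Qed.

Lemma mres_eq0 F U (s : F U) :
  (forall x, opens_set U x -> exists (W : opens X) (WU : W `<=` U),
     opens_set W x /\ mres F WU s = 0) -> s = 0.
Proof.
move=> s0; apply: (sheaf_sep (msec_sheaf F)) => x /s0[W [WU [Wx sW]]].
by exists W, WU; rewrite raddf0.
Qed.

Lemma res_eq0 U (a : sec U) :
  (forall x, opens_set U x -> exists (W : opens X) (WU : W `<=` U),
     opens_set W x /\ res WU a = 0) -> a = 0.
Proof.
move=> s0; apply: (sheaf_sep (sec_sheaf X)) => x /s0[W [WU [Wx sW]]].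
by exists W, WU; rewrite rmorph0.
Qed.

Lemma mres_empty F U (s : F U) : ~ (U !=set0) -> s = 0.
Proof. by move=> U0; apply: mres_eq0 => x Ux; case: U0; exists x. Qed.

Definition ohom_comp F G H (v : ohom G H) (u : ohom F G) : ohom F H.
Proof.
pose w U := [the {linear F U -> H U} of v U \o u U].
by exists w => U V UV s /=; rewrite !ohom_nat.
Defined.

Definition ohom_id F : ohom F F.
Proof.
pose w U := [the {linear F U -> F U} of idfun].
by exists w.
Defined.

Definition ohom_null F G : ohom F G.
Proof.
pose w U := [the {linear F U -> G U} of \0].
by exists w => U V UV s /=; rewrite raddf0.
Defined.

End Restriction.

(** * Ideals, units and restriction of scalars *)

Record ideal (A : comPzRingType) (J : set A) : Prop := Ideal {
  ideal0 : J 0;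
  idealD : forall a b, J a -> J b -> J (a + b);
  idealM : forall a b, J b -> J (a * b) }.

Lemma prime_ideal_exp (A : comPzRingType) (P : set A) (f : A) n :
  prime_ideal P -> P (f ^+ n) -> P f.
Proof.
move=> PP; elim: n => [/(prime_ideal1 PP)//|n IH].
by rewrite exprS => /(prime_idealP PP)[].
Qed.

(** Krull's theorem. It takes the place of finite coverings below: to see that a
    power of f lies in an ideal J, it is enough that no prime that avoids f
    contains J, and this is a local question at the points of D(f). *)
Lemma prime_avoiding (A : comPzRingType) (J : set A) (f : A) :
  ideal J -> (forall n, ~ J (f ^+ n)) ->
  exists P : spec A, J `<=` P /\ ~ spec_set P f.
Proof.
move=> Jid Jf.
pose C (I : set A) := [/\ ideal I, J `<=` I & forall n, ~ I (f ^+ n)].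
(* Zorn's lemma wants the union of the empty chain to be admissible, whence
   the extra disjunct I = set0. *)
have [F FC Ftot|I [CI Imax]] := @Zorn_bigcup A [set I | I = set0 \/ C I].
  have [[I0 [FI0 CI0]]|FC0] := pselect (exists I, F I /\ C I); last first.
    left; apply/seteqP; split=> // a [I FI Ia].
    by have [I0|CI] := FC I FI; [rewrite -I0|case: FC0; exists I].
  have FCI I a : F I -> I a -> C I by move=> /FC[->|].
  right; have [Iid JI If] := CI0; split.
  - split; first by exists I0 => //; exact: ideal0 Iid.
      move=> a b [I FI Ia] [K FK Kb].
      have [IK|KI] := Ftot _ _ FI FK; [exists K|exists I] => //.
        by have [Kid _ _] := FCI _ _ FK Kb; apply: idealD Kid _ _ (IK _ Ia) Kb.
      by have [Iid' _ _] := FCI _ _ FI Ia; apply: idealD Iid' _ _ Ia (KI _ Kb).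
    move=> a b [I FI Ib]; exists I => //.
    by have [Iid' _ _] := FCI _ _ FI Ib; apply: idealM Iid' _ _ Ib.
  - by move=> a Ja; exists I0 => //; apply: JI.
  - by move=> n [I FI Ia]; have [_ _ /(_ n)] := FCI _ _ FI Ia.
have {}CI : C I.
  case: CI => // I0; suff : ~ C J by case; split.
  move=> CJ; apply: (Imax J); last by right.
  rewrite I0; split=> // J0; exact: (J0 _ (ideal0 Jid)).
have [Iid JI If] := CI.
(* By maximality, the ideal generated by I and a contains a power of f. *)
have big a : ~ I a -> exists n b i, I i /\ f ^+ n = i + b * a.
  move=> Ia; apply: contrapT => nf.
  apply: (Imax [set x | exists b i, I i /\ x = i + b * a]).
    split=> [x Ix|sub]; first by exists 0, x; rewrite mul0r addr0.
    by apply: Ia; apply: sub; exists 1, 0; rewrite mul1r add0r;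
      split=> //; apply: ideal0 Iid.
  right; split.
  - split.
      by exists 0, 0; rewrite mul0r addr0; split=> //; apply: ideal0 Iid.
      move=> _ _ [b [i [Ii ->]]] [c [j [Ij ->]]]; exists (b + c), (i + j).
      by split; [exact: idealD Iid _ _ Ii Ij | rewrite mulrDl addrACA].
    move=> x _ [b [i [Ii ->]]]; exists (x * b), (x * i).
    by split; [exact: idealM Iid _ _ Ii | rewrite mulrDr mulrA].
  - by move=> x /JI Ix; exists 0, x; rewrite mul0r addr0.
  - by move=> n [b [i [Ii fE]]]; apply: nf; exists n, b, i.
have PI : prime_ideal I.
  split; [exact: ideal0 Iid|exact: idealD Iid|exact: idealM Iid| |].
    by move=> I1; apply: (If 0%N).
  move=> a b Iab; apply: contrapT => /not_orP[/big[n [c [i [Ii fn]]]]].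
  move=> /big[m [d [j [Ij fm]]]]; apply: (If (n + m)%N).
  rewrite exprD fn fm mulrDr; apply: (idealD Iid).
    exact: (idealM Iid).
  rewrite mulrDl; apply: (idealD Iid).
    by rewrite mulrC; exact: (idealM Iid).
  by rewrite mulrACA; exact: (idealM Iid).
exists (Spec PI); split=> //= fI; apply: (If 1%N).
by rewrite expr1.
Qed.

Lemma unit_exp (A : comPzRingType) (a v : A) n :
  a * v = 1 -> a ^+ n * v ^+ n = 1.
Proof. by move=> av; rewrite -exprMn av expr1n. Qed.

Lemma unit_scale_eq0 (A : comPzRingType) (M : lmodType A) (a : A) (x : M) n :
  (exists v, a * v = 1) -> a ^+ n *: x = 0 -> x = 0.
Proof.
move=> [v /(unit_exp n) av] ax.
by rewrite -[x]scale1r -av mulrC -scalerA ax scaler0.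
Qed.

(** The morphism phi is an argument of the type so that the A-module structure
    can be inferred from it. *)
Definition restrict_scalars (A B : comPzRingType) (phi : {rmorphism A -> B})
  (N : lmodType B) : Type := N.

Section RestrictScalars.
Variables (A B : comPzRingType) (phi : {rmorphism A -> B}) (N : lmodType B).
Local Notation N' := (restrict_scalars phi N).

HB.instance Definition _ := GRing.Zmodule.on N'.

Let scale (a : A) (x : N') : N' := phi a *: (x : N).

Let scaleA a b x : scale a (scale b x) = scale (a * b) x.
Proof. by rewrite /scale scalerA rmorphM. Qed.
Let scale1 : left_id 1 scale.
Proof. by move=> x; rewrite /scale rmorph1 scale1r. Qed.
Let scaleDr : right_distributive scale +%R.
Proof. by move=> a x y; rewrite /scale scalerDr. Qed.
Let scaleDl x : {morph scale^~ x : a b / a + b}.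
Proof. by move=> a b; rewrite /scale rmorphD scalerDl. Qed.

HB.instance Definition _ := GRing.Zmodule_isLmodule.Build A N'
  scaleA scale1 scaleDr scaleDl.

(** The identity, seen as a phi-semilinear map. *)
Definition restrict_scalars_id : N' -> N := id.

Let restrict_scalars_idL : linear_for (phi \; *:%R) restrict_scalars_id.
Proof. by []. Qed.

HB.instance Definition _ :=
  GRing.isLinear.Build A N' N (phi \; *:%R) restrict_scalars_id
    restrict_scalars_idL.

End RestrictScalars.

(** * Affine charts *)

Section Charts.
Variables (X : ringedSpace) (U : opens X) (c : affineChart U).
Notation A := (chart_ring c).

Lemma open_basic_open (R : comPzRingType) (f : R) : open (basic_open f).
Proof.
exists [set f]; apply/seteqP; split=> P /=; first by move=> Pf /(_ f erefl).
by move=> Pf fP; apply: Pf => _ ->.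
Qed.

Definition chart_basic (f : A) : opens X :=
  Opens (chart_open (open_basic_open f)).

Lemma chart_ptU (P : spec A) : opens_set U (chart_pt c P).
Proof. by rewrite -(chart_range c); exists P. Qed.

Lemma chart_basicS f : chart_basic f `<=` U.
Proof. by move=> _ [P _ <-]; apply: chart_ptU. Qed.

Lemma chart_basicP f (P : spec A) :
  opens_set (chart_basic f) (chart_pt c P) <-> ~ spec_set P f.
Proof.
by split=> [[Q Qf /chart_inj <-]//|Pf]; exists P.
Qed.

(** The basic open sets D(f) form a basis of the topology of a chart. *)
Lemma chart_nbhs (P : spec A) (W : opens X) : opens_set W (chart_pt c P) ->
  exists f, ~ spec_set P f /\ chart_basic f `<=` W.
Proof.
move=> Wx.
have : open (chart_pt c @^-1` W).
  by apply: open_comp (opens_open W) => ? _; exact: chart_continuous.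
case=> E WE; have : (chart_pt c @^-1` W) P by [].
rewrite WE => /existsNP[f /not_implyP[Ef Pf]]; exists f; split=> //.
move=> _ [Q Qf <-]; change ((chart_pt c @^-1` W) Q); rewrite WE.
by move=> /(_ f Ef).
Qed.

Lemma chart_mem x : opens_set U x -> exists P, chart_pt c P = x.
Proof. by rewrite -(chart_range c) => -[P _ <-]; exists P. Qed.

Lemma chart_unit f (W : opens X) (WU : W `<=` U) : W `<=` chart_basic f ->
  exists v, res WU (chart_sec c f) * v = 1.
Proof.
move=> Wf; have [[v fv] _ _] := @chart_loc _ _ c f _ (@chart_basicS f) erefl.
exists (res Wf v); rewrite -(rmorph1 (res Wf)) -fv rmorphM /=.
by rewrite (res_comp _ _ WU).
Qed.

Lemma chart_sec_inj a : chart_sec c a = 0 -> a = 0.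
Proof.
move=> a0; have [_ _ /(_ a)] := @chart_loc _ _ c 1 _ (@chart_basicS 1) erefl.
by rewrite a0 rmorph0 => -[//|n]; rewrite expr1n mul1r.
Qed.

(** Together with [chart_unit]: D(f) is the largest open subset of U on which f
    is locally invertible. This describes D(f) independently of the chart, and
    so allows two charts to be compared. *)
Lemma chart_unit_basic f x (W : opens X) (WU : W `<=` U) :
  opens_set W x -> (exists v, res WU (chart_sec c f) * v = 1) ->
  opens_set (chart_basic f) x.
Proof.
move=> Wx [v fv].
have [P Px] := chart_mem (WU _ Wx).
move: Wx; rewrite -Px => /chart_nbhs[g [Pg gW]].
have [_ frac ker] := @chart_loc _ _ c g _ (@chart_basicS g) erefl.
have [n [a va]] := frac (res gW v).
have /ker[m] : res (@chart_basicS g) (chart_sec c (f * a - g ^+ n)) = 0.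
  rewrite rmorphB rmorphM rmorphXn /= rmorphB rmorphM /= -va.
  rewrite mulrCA -(res_comp gW WU _ (chart_sec c f)) -rmorphM fv rmorph1.
  by rewrite mulr1 !rmorphXn subrr.
move/eqP; rewrite mulrBr subr_eq0 -exprD => /eqP fg.
apply/chart_basicP => Pf; have PP := spec_prime P.
have : spec_set P (g ^+ (m + n)).
  by rewrite -fg mulrCA mulrC; exact: (prime_idealM PP).
by move/(prime_ideal_exp PP).
Qed.

End Charts.

Arguments chart_basic {X U} c f.
Arguments chart_basicS {X U} c f.

Section ChartBasics.
Variables (X : ringedSpace) (U : opens X) (c : affineChart U).

Lemma chart_basicM (f g : chart_ring c) x :
  opens_set (chart_basic c (f * g)) x <->
  opens_set (chart_basic c f) x /\ opens_set (chart_basic c g) x.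
Proof.
split=> [[P Pfg <-]|[[P Pf <-]] /chart_basicP Pg].
  have PP := spec_prime P; split; apply/chart_basicP => Pa; apply: Pfg.
    by rewrite mulrC; exact: (prime_idealM PP).
  exact: (prime_idealM PP).
by apply/chart_basicP => /(prime_idealP (spec_prime P))[].
Qed.

Lemma chart_basicD (f g : chart_ring c) :
  chart_basic c (f + g) `<=` chart_basic c f `|` chart_basic c g.
Proof.
move=> _ [P Pfg <-]; apply: contrapT => /not_orP[].
move=> /chart_basicP/contrapT Pf /chart_basicP/contrapT Pg.
by apply: Pfg; apply: prime_idealD (spec_prime P) _ _ Pf Pg.
Qed.

Lemma chart_basic0 : ~ (chart_basic c 0 !=set0).
Proof. by move=> [_ [P P0 _]]; apply/P0/(prime_ideal0 (spec_prime P)). Qed.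

(** Quasi-compactness of affine open sets, as an induction principle. The a
    such that D(a) satisfies Phi form an ideal, because D(a + b) is covered by
    D(a) and D(b); as Phi holds locally, no prime contains this ideal. *)
Lemma affine_open_ind (Phi : opens X -> Prop) :
  (forall W : opens X, ~ (W !=set0) -> Phi W) ->
  (forall W V1 V2 : opens X, W `<=` V1 `|` V2 -> Phi V1 -> Phi V2 -> Phi W) ->
  (forall x, opens_set U x -> exists2 W : opens X, opens_set W x & Phi W) ->
  Phi U.
Proof.
move=> Phi0 PhiU Phix.
have PhiS (W V : opens X) : W `<=` V -> Phi V -> Phi W.
  by move=> WV PV; apply: (PhiU W V V) => // x /WV; left.
pose J := [set a | Phi (chart_basic c a)].
have Jid : ideal J.
  split=> [|a b Ja Jb|a b Jb]; rewrite /J /=.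
  - exact/Phi0/chart_basic0.
  - exact: PhiU (@chart_basicD a b) Ja Jb.
  - by apply: PhiS Jb => x /chart_basicM[].
suff J1 : J 1.
  apply: PhiS J1 => x /(chart_mem c)[P <-]; apply/chart_basicP.
  exact: prime_ideal1 (spec_prime P).
apply: contrapT => J1.
have [|P [JP _]] := prime_avoiding (f := 1) Jid.
  by move=> n; rewrite expr1n.
have [W WP PhiW] := Phix _ (chart_ptU P).
have [g [Pg gW]] := chart_nbhs WP.
by apply: Pg; apply: JP; apply: PhiS PhiW.
Qed.

End ChartBasics.

(** * Quasi-coherence as a condition on sections *)

Section LocalizesOn.
Variable X : ringedSpace.

Lemma opens_eq (U V : opens X) : (U : set X) = V -> U = V.
Proof.
case: U V => [U Uo] [V Vo] /= E; move: Uo Vo; rewrite E => Uo Vo.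
by congr Opens; apply: Prop_irrelevance.
Qed.

(** The canonical comparison map from F(U)_f to F(D(f)) is injective and
    surjective, for all f in the ring of the chart. By [qcoh_localizes], this
    is quasi-coherence with F(U) itself as the module, so that no module has
    to be exhibited. *)
Definition localizes_on (F : omodule X) (U : opens X) (c : affineChart U) :=
  forall f,
  (forall x : F U, mres F (chart_basicS c f) x = 0 ->
     exists n, chart_sec c f ^+ n *: x = 0) /\
  (forall y : F (chart_basic c f), exists n x,
     res (chart_basicS c f) (chart_sec c f) ^+ n *: y
     = mres F (chart_basicS c f) x).

Lemma chart_basic1 (U : opens X) (c : affineChart U) :
  (U : set X) = chart_pt c @` basic_open 1.
Proof.
rewrite -(chart_range c); congr (_ @` _); apply/esym; rewrite -subTset => P _.
exact: prime_ideal1 (spec_prime P).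
Qed.

Lemma associated_localizes (F : omodule X) (U : opens X) (c : affineChart U)
    (M : lmodType (chart_ring c)) :
  associated_on F M -> localizes_on F c.
Proof.
move=> [mu mu_loc] f.
have [_ surj _] := mu_loc 1 U (@subset_refl _ U) (chart_basic1 c).
have [_ frac ker] := mu_loc f _ (chart_basicS c f) erefl.
split=> [x|y]; last by have [n [m E]] := frac y; exists n, (mu m).
have [k [m]] := surj x; rewrite rmorph1 rmorph1 expr1n scale1r mres_id => ->.
move=> /ker[n fm]; exists n.
by rewrite -rmorphXn -[_ *: _]/((chart_sec c \; *:%R) _ _) -linearZ /= fm linear0.
Qed.

Lemma localizes_associated (F : omodule X) (U : opens X) (c : affineChart U) :
  localizes_on F c ->
  associated_on F ([the lmodType _ of restrict_scalars (chart_sec c) (F U)]).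
Proof.
move=> Floc; exists [the {linear _ -> _ | _} of
  @restrict_scalars_id _ _ (chart_sec c) (F U)].
move=> f W WU WE; have {WE}E : W = chart_basic c f by apply: opens_eq.
subst W; rewrite (Prop_irrelevance WU (chart_basicS c f)).
have [ker frac] := Floc f; split.
- have [v fv] := chart_unit (chart_basicS c f) (@subset_refl _ _).
  exists (fun y => v *: y) => y; rewrite scalerA ?fv ?scale1r //.
  by rewrite mulrC fv scale1r.
- exact: frac.
- move=> x /ker[n fx]; exists n.
  by rewrite -[RHS]fx -rmorphXn.
Qed.

End LocalizesOn.

Lemma qcoh_localizes (X : scheme) (F : omodule X) :
  quasi_coherent F <->
  forall x : X, exists U : opens X, opens_set U x /\
    exists c : affineChart U, localizes_on F c.
Proof.
split=> H x; have [U [Ux [c Fc]]] := H x; exists U; split=> //; exists c.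
  by have [M] := Fc; exact: associated_localizes.
exists ([the lmodType _ of restrict_scalars (chart_sec c) (F U)]).
exact: localizes_associated.
Qed.

(** The injectivity of the localization maps is inherited from U by D(f): f is
    invertible on D(f), so t may be replaced by the restriction of a section
    over U. *)
Lemma localizes_on_basic (X : ringedSpace) (F : omodule X) (U : opens X)
    (c : affineChart U) (f g : chart_ring c)
    (gf : chart_basic c g `<=` chart_basic c f) (t : F (chart_basic c f)) :
  localizes_on F c -> mres F gf t = 0 ->
  exists m, res (chart_basicS c f) (chart_sec c g) ^+ m *: t = 0.
Proof.
move=> Fc tg; have [_ frac] := Fc f; have [n [s sE]] := frac t.
have [ker _] := Fc g; have [|m gs] := ker s.
  by rewrite -(mres_comp gf (chart_basicS c f)) -sE mresZ tg scaler0.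
exists m; apply: (unit_scale_eq0 (n := n)
  (chart_unit (chart_basicS c f) (@subset_refl _ _))).
by rewrite scalerA mulrC -scalerA sE -rmorphXn -mresZ gs raddf0.
Qed.

(** * Subsheaves *)

(** The data needed to cut an O_X-submodule out of F: sections satisfying a
    linear, restriction-stable and local condition. *)
Record subsheaf (X : ringedSpace) (F : omodule X) := Subsheaf {
  smem :> forall U : opens X, set (F U);
  smem0 : forall U : opens X, smem (0 : F U);
  smemZD : forall U (a : sec U) (s t : F U),
    smem s -> smem t -> smem (a *: s + t);
  smem_res : forall (U V : opens X) (UV : U `<=` V) (s : F V),
    smem s -> smem (mres F UV s);
  smem_local : forall (U : opens X) (s : F U),
    (forall x, opens_set U x -> exists (W : opens X) (WU : W `<=` U),
      opens_set W x /\ smem (mres F WU s)) -> smem s }.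

Section SubsheafModule.
Variables (X : ringedSpace) (F : omodule X) (S : subsheaf F).

Definition smem_pred (U : opens X) : pred (F U) := fun s => `[< S U s >].

Let smem_closed U : GRing.subsemimod_closed (@smem_pred U).
Proof.
split; first split=> [|s t /asboolP Ss /asboolP St].
- exact: asboolT (smem0 S U).
- by apply: asboolT; rewrite -[s]scale1r; apply: smemZD.
- move=> a s /asboolP Ss; apply: asboolT.
  by rewrite -[_ *: _]addr0; apply: smemZD => //; apply: smem0.
Qed.

HB.instance Definition _ U :=
  GRing.isSubmodClosed.Build (sec U) (F U) (@smem_pred U) (@smem_closed U).

Definition subsheaf_sec (U : opens X) := {s : F U | smem_pred s}.

HB.instance Definition _ U := SubChoice.on (subsheaf_sec U).
HB.instance Definition _ U :=
  [SubChoice_isSubLmodule of subsheaf_sec U by <:].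

Lemma subsheaf_secP U (s : subsheaf_sec U) : S U (val s).
Proof. exact/asboolP/(valP s). Qed.

Definition mk_subsheaf_sec U (s : F U) (Ss : S U s) : subsheaf_sec U :=
  exist _ s (asboolT Ss).

Definition subsheaf_res (U V : opens X) (UV : U `<=` V) (s : subsheaf_sec V) :=
  mk_subsheaf_sec (smem_res UV (subsheaf_secP s)).

Let subsheaf_resL (U V : opens X) (UV : U `<=` V) :
  linear_for (res UV \; *:%R) (subsheaf_res UV).
Proof. by move=> a s t; apply: val_inj; exact: linearP. Qed.

HB.instance Definition _ (U V : opens X) (UV : U `<=` V) :=
  GRing.isLinear.Build (sec V) (subsheaf_sec V) (subsheaf_sec U) (res UV \; *:%R)
    (subsheaf_res UV) (subsheaf_resL UV).

Lemma subsheaf_is_sheaf : @is_sheaf X subsheaf_sec subsheaf_res.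
Proof.
have FF := msec_sheaf F; split.
- by move=> U UU s; apply: val_inj; rewrite /= mres_id.
- by move=> U V W UV VW UW s; apply: val_inj; rewrite /= (mres_comp UV VW UW).
- move=> I V U UV cov s ss.
  have [i j|t [tE tu]] := sheaf_glue FF UV cov (s := fun i => val (s i)).
    exact: (congr1 val (ss i j)).
  have St : S V t.
    apply: smem_local => x /cov[i _ Ux]; exists (U i), (UV i); split=> //.
    by rewrite tE; apply: subsheaf_secP.
  exists (mk_subsheaf_sec St); split=> [i|t' t'E]; apply: val_inj => //=.
  by apply: tu => i; rewrite -t'E.
Qed.

Definition subsheaf_omodule : omodule X :=
  @OModule X (fun U => [the lmodType _ of subsheaf_sec U])
    (fun (U V : opens X) (UV : U `<=` V) =>
      [the {linear _ -> _ | _} of @subsheaf_res U V UV])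
    subsheaf_is_sheaf.

Definition subsheaf_incl : ohom subsheaf_omodule F :=
  @OHom X subsheaf_omodule F (fun U => [the {linear _ -> _} of val])
    (fun U V UV s => erefl).

Lemma subsheaf_incl_inj U (s t : subsheaf_omodule U) :
  subsheaf_incl U s = subsheaf_incl U t -> s = t.
Proof. exact: val_inj. Qed.

Lemma subsheaf_inclP U (s : subsheaf_omodule U) : S U (subsheaf_incl U s).
Proof. exact: subsheaf_secP. Qed.

Section Factor.
Variables (G : omodule X) (u : ohom G F) (uS : forall U s, S U (u U s)).

Definition subsheaf_factor_fun (U : opens X) (s : G U) : subsheaf_sec U :=
  mk_subsheaf_sec (uS s).

Let subsheaf_factorL U : linear (@subsheaf_factor_fun U).
Proof. by move=> a s t; apply: val_inj; rewrite /= linearP. Qed.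

HB.instance Definition _ U :=
  GRing.isLinear.Build (sec U) (G U) (subsheaf_sec U) *:%R
    (@subsheaf_factor_fun U) (@subsheaf_factorL U).

Lemma subsheaf_factor_nat (U V : opens X) (UV : U `<=` V) (s : G V) :
  subsheaf_res UV (subsheaf_factor_fun s) = subsheaf_factor_fun (mres G UV s).
Proof. by apply: val_inj; rewrite /= ohom_nat. Qed.

Definition subsheaf_factor : ohom G subsheaf_omodule :=
  @OHom X G subsheaf_omodule
    (fun U => [the {linear _ -> _} of @subsheaf_factor_fun U])
    subsheaf_factor_nat.

End Factor.

(** Injectivity of localization is inherited by subsheaves; what has to be
    checked is that f^n s extends inside the subsheaf. *)
Lemma subsheaf_localizes (U : opens X) (c : affineChart U) :
  localizes_on F c ->
  (forall f (s : F (chart_basic c f)), S _ s -> exists n (t : F U), S U t /\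
     res (chart_basicS c f) (chart_sec c f) ^+ n *: s
       = mres F (chart_basicS c f) t) ->
  localizes_on subsheaf_omodule c.
Proof.
move=> Floc ext f; have [ker _] := Floc f; split.
  move=> s /(congr1 (subsheaf_incl _)); rewrite -ohom_nat raddf0 => /ker[n sn].
  by exists n; apply: subsheaf_incl_inj; rewrite linearZ /= sn.
move=> s; have [n [t [St E]]] := ext _ _ (subsheaf_secP s).
by exists n, (mk_subsheaf_sec St); apply: subsheaf_incl_inj.
Qed.

End SubsheafModule.

(** * Integral schemes *)

Section IntegralScheme.
Variables (X : scheme) (hX : integral_scheme X).

(** If U and V were disjoint, the function equal to 1 on U and to 0 on V would
    be a nontrivial idempotent over their union. *)
Lemma irreducible (U V : opens X) : U !=set0 -> V !=set0 -> opensI U V !=set0.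
Proof.
move=> U0 V0; apply: contrapT => UV0.
have [_ dom] := hX; pose W := opensU U V.
have UW : U `<=` W by move=> x; left.
have VW : V `<=` W by move=> x; right.
have [||e [eU eV]] := @sheaf_glue2 _ _ _ (sec_sheaf X) W U V UW VW 1 0.
- by [].
- move=> W' WU WV; apply: (sheaf_sep (sec_sheaf X)) => x Wx.
  by case: UV0; exists x; split; [exact: WU | exact: WV].
have W0 : W !=set0 by have [x Ux] := U0; exists x; left.
have [U1 _] := dom U U0; have [V1 _] := dom V V0.
have [_ /(_ e (1 - e))[|e0|e1]] := dom W W0.
- apply: res_eq0 => x [Ux|Vx]; [exists U, UW|exists V, VW]; split=> //.
    by rewrite rmorphM rmorphB rmorph1 eU subrr mulr0.
  by rewrite rmorphM eV mul0r.
- by apply: U1; rewrite -eU e0 rmorph0.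
- apply: V1; rewrite -(rmorph1 (res VW)) -eV; apply/eqP.
  by rewrite -subr_eq0 -rmorphB e1 rmorph0.
Qed.

Lemma chart_domain (U : opens X) (c : affineChart U) :
  U !=set0 -> integral_domain (chart_ring c).
Proof.
move=> U0; have [nz dom] := (proj2 hX) U U0; split.
  by move=> e; apply: nz; rewrite -(rmorph1 (chart_sec c)) e rmorph0.
move=> a b ab; have : chart_sec c a * chart_sec c b = 0.
  by rewrite -rmorphM ab rmorph0.
by case/dom => /chart_sec_inj; [left|right].
Qed.

Lemma zero_prime (A : comPzRingType) :
  integral_domain A -> prime_ideal [set a : A | a = 0].
Proof.
case=> nz dom; split=> //=.
- by move=> a b -> ->; rewrite addr0.
- by move=> a b ->; rewrite mulr0.
Qed.

Lemma chart_basic_neq0 (U : opens X) (c : affineChart U) f :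
  chart_basic c f !=set0 -> f <> 0.
Proof.
case=> _ [P Pf _] f0; apply: Pf; rewrite f0; exact: prime_ideal0 (spec_prime P).
Qed.

(** D(f) contains the point of the zero ideal. *)
Lemma chart_basic_nonempty (U : opens X) (c : affineChart U) f :
  U !=set0 -> f <> 0 -> chart_basic c f !=set0.
Proof.
move=> U0 f0; have P0 := zero_prime (chart_domain c U0).
by exists (chart_pt c (Spec P0)); apply/chart_basicP.
Qed.

(** The germ of a at some point x is nonzero. Near x one has a = b / f^n in a
    chart, with b nonzero, and a is invertible on D(f b). *)
Lemma nonzero_unit (U : opens X) (a : sec U) : a <> 0 ->
  exists (W : opens X) (WU : W `<=` U),
    W !=set0 /\ exists v, res WU a * v = 1.
Proof.
move=> a0.
have [x [Ux ax]] : exists x, opens_set U x /\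
    forall (W : opens X) (WU : W `<=` U), opens_set W x -> res WU a <> 0.
  apply: contrapT => nx; apply: a0; apply: res_eq0 => x Ux.
  apply: contrapT => nW; apply: nx; exists x; split=> // W WU Wx aW.
  by apply: nW; exists W, WU.
have [V Vx [c]] := scheme_affine x.
have [P Px] := chart_mem c Vx.
move: Ux; rewrite -Px => /chart_nbhs[f [Pf fU]].
have Df := chart_basicS c f.
have [_ frac _] := @chart_loc _ _ c f _ Df erefl.
have [n [b fb]] := frac (res fU a).
have V0 : V !=set0 by exists x.
have fx : opens_set (chart_basic c f) x by rewrite -Px; apply/chart_basicP.
have [u fu] := chart_unit Df (@subset_refl _ _).
have b0 : b <> 0.
  move=> b0; apply: (ax _ fU fx).
  rewrite -[LHS]mul1r -(expr1n _ n) -fu exprMn mulrAC fb b0.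
  by rewrite !rmorph0 mul0r.
have f0 : f <> 0 by apply: (@chart_basic_neq0 _ c); exists x.
have [_ dom] := chart_domain c V0.
have [|y] := @chart_basic_nonempty _ c (f * b) V0.
  by case/dom.
move=> [Q Qfb Qy].
have gf : chart_basic c (f * b) `<=` chart_basic c f by move=> z /chart_basicM[].
have gb : chart_basic c (f * b) `<=` chart_basic c b by move=> z /chart_basicM[].
exists (chart_basic c (f * b)), (subset_trans gf fU); split.
  by exists y, Q.
have [v bv] := chart_unit (subset_trans gf Df) gb.
exists (res gf (res Df (chart_sec c f) ^+ n) * v).
move/(congr1 (res gf)): fb.
rewrite rmorphM /= (res_comp gf Df (subset_trans gf Df)) => E.
by rewrite mulrA -(res_comp gf fU) [X in X * v]mulrC E.
Qed.

End IntegralScheme.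

(** * Torsion-free sheaves and the torsion subsheaf *)

(** Torsion-freeness without reference to affine open sets or to annihilators,
    and hence easy to transport between open sets. *)
Definition generically_separated (X : ringedSpace) (F : omodule X) :=
  forall (U W : opens X) (WU : W `<=` U) (s : F U),
  W !=set0 -> mres F WU s = 0 -> s = 0.

Section TorsionFree.
Variables (X : scheme) (hX : integral_scheme X).

Lemma torsion_free_exp (F : qcoh X) (U : opens X) (a : sec U) (s : F U) n :
  locally_torsion_free F -> affine_open U -> U !=set0 ->
  a <> 0 -> a ^+ n *: s = 0 -> s = 0.
Proof.
move=> Ftf Uaff U0 a0; elim: n => [|n IH]; first by rewrite expr0 scale1r.
by rewrite exprS -scalerA => /(Ftf U Uaff U0)[/a0|/IH].
Qed.

(** A torsion section vanishes where its annihilator is invertible. Conversely,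
    if s vanishes on W, then in a chart f^n s extends to a section t which
    vanishes on a nonempty D(g) inside W, so t is killed by a power of g. *)
Lemma generically_separatedP (F : qcoh X) :
  locally_torsion_free F <-> generically_separated F.
Proof.
split=> [Ftf U W WU s W0 sW|Fsep U _ _ a s as0]; last first.
  have [->|/eqP/(nonzero_unit hX)[W [WU [W0 aW]]]] := eqVneq a 0; [by left|right].
  apply: (Fsep _ _ WU _ W0); apply: (unit_scale_eq0 (n := 1) aW).
  by rewrite expr1 -mresZ as0 raddf0.
apply: mres_eq0 => x Ux.
have [V [Vx [c Fc]]] := proj1 (qcoh_localizes F) (qcohP F) x.
have V0 : V !=set0 by exists x.
have [P Px] := chart_mem c Vx.
move: (Ux); rewrite -Px => /chart_nbhs[f [Pf fU]].
have fx : opens_set (chart_basic c f) x by rewrite -Px; apply/chart_basicP.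
exists (chart_basic c f), fU; split; first by rewrite Px.
have [_ frac] := Fc f; have [n [t tE]] := frac (mres F fU s).
apply: (unit_scale_eq0 (n := n)
  (chart_unit (chart_basicS c f) (@subset_refl _ _))).
rewrite tE; suff -> : t = 0 by rewrite raddf0.
have D0 : chart_basic c f !=set0 by exists x.
have [y [fy Wy]] := irreducible hX D0 W0.
have [Q Qy] := chart_mem c (chart_basicS c f y fy).
have fWy : opens_set (opensI (chart_basic c f) W) (chart_pt c Q) by rewrite Qy.
have [g [Qg gfW]] := chart_nbhs fWy.
have gf : chart_basic c g `<=` chart_basic c f by move=> z /gfW[].
have gW : chart_basic c g `<=` W by move=> z /gfW[].
have g0 : g <> 0.
  by move=> g0; apply: Qg; rewrite g0; exact: prime_ideal0 (spec_prime Q).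
have [ker _] := Fc g; have [|m gt] := ker t.
  rewrite -(mres_comp gf (chart_basicS c f)) -tE mresZ.
  rewrite (mres_comp gf fU (subset_trans gW WU)).
  by rewrite -(mres_comp gW WU) sW raddf0 scaler0.
apply: (torsion_free_exp (a := chart_sec c g) Ftf _ V0 _ gt).
  by constructor.
by move/chart_sec_inj.
Qed.

(** The torsion sections, described as in [generically_separated]. On the empty
    open set the condition W !=set0 is waived, so that 0 qualifies. *)
Definition vanishes_generically (F : omodule X) (U : opens X) : set (F U) :=
  [set s | exists (W : opens X) (WU : W `<=` U),
    (U !=set0 -> W !=set0) /\ mres F WU s = 0].

Lemma vanishes_generically0 (F : omodule X) (U : opens X) :
  vanishes_generically (0 : F U).
Proof. by exists U, (@subset_refl _ _); rewrite raddf0. Qed.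

Lemma vanishes_genericallyZD (F : omodule X) (U : opens X) (a : sec U)
    (s t : F U) :
  vanishes_generically s -> vanishes_generically t ->
  vanishes_generically (a *: s + t).
Proof.
move=> [W [WU [W0 sW]]] [V [VU [V0 tV]]].
have WVW : opensI W V `<=` W by exact: subIsetl.
have WVV : opensI W V `<=` V by exact: subIsetr.
exists (opensI W V), (subset_trans WVW WU); split.
  by move=> U0; apply: (irreducible hX); [exact: W0 | exact: V0].
rewrite raddfD /= mresZ -(mres_comp WVW WU) sW raddf0 scaler0.
by rewrite -(mres_comp WVV VU) tV raddf0 addr0.
Qed.

Lemma vanishes_generically_res (F : omodule X) (U V : opens X) (UV : U `<=` V)
    (s : F V) :
  vanishes_generically s -> vanishes_generically (mres F UV s).
Proof.
move=> [W [WV [W0 sW]]].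
have WUW : opensI W U `<=` W by exact: subIsetl.
have WUU : opensI W U `<=` U by exact: subIsetr.
exists (opensI W U), WUU; split=> [U0|].
  apply: (irreducible hX) => //; apply: W0.
  by have [x Ux] := U0; exists x; apply: UV.
rewrite (mres_comp _ _ (subset_trans WUU UV)).
by rewrite -(mres_comp WUW WV) sW raddf0.
Qed.

Lemma vanishes_generically_local (F : omodule X) (U : opens X) (s : F U) :
  (forall x, opens_set U x -> exists (W : opens X) (WU : W `<=` U),
    opens_set W x /\ vanishes_generically (mres F WU s)) ->
  vanishes_generically s.
Proof.
move=> loc; have [U0|U0] := pselect (U !=set0); last first.
  by rewrite (mres_empty s U0); exact: vanishes_generically0.
have [x Ux] := U0; have [V [VU [Vx [W [WV [W0 sW]]]]]] := loc x Ux.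
exists W, (subset_trans WV VU); split; first by move=> _; apply: W0; exists x.
by rewrite -(mres_comp WV VU).
Qed.

Definition generically_zero (F : omodule X) : subsheaf F :=
  Subsheaf (@vanishes_generically0 F) (@vanishes_genericallyZD F)
    (@vanishes_generically_res F) (@vanishes_generically_local F).

(** If f^n s extends to t and s vanishes on a nonempty open subset of D(f), then
    so does t. When D(f) is empty, t must be chosen to be 0. *)
Lemma torsion_qcoh (F : qcoh X) :
  quasi_coherent (subsheaf_omodule (generically_zero F)).
Proof.
apply/qcoh_localizes => x.
have [U [Ux [c Fc]]] := proj1 (qcoh_localizes F) (qcohP F) x.
exists U; split=> //; exists c.
apply: subsheaf_localizes => // f s [W [Wf [W0 sW]]].
have [f0|f0] := pselect (chart_basic c f !=set0); last first.
  exists 0%N, 0; split; first exact: smem0.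
  by rewrite raddf0 (mres_empty s f0) scaler0.
have [_ frac] := Fc f; have [n [t tE]] := frac s; exists n, t; split=> //.
exists W, (subset_trans Wf (chart_basicS c f)); split=> [_|]; first exact: W0.
by rewrite -(mres_comp Wf (chart_basicS c f)) -tE mresZ sW scaler0.
Qed.

Definition torsion (F : qcoh X) : qcoh X := QCoh (torsion_qcoh F).

Lemma torsion_hom_zero (F G : qcoh X) :
  locally_torsion_free G -> ohom_zero (torsion F) G.
Proof.
move=> /generically_separatedP Gsep u U s.
have [U0|U0] := pselect (U !=set0); last exact: mres_empty.
have [W [WU [W0 sW]]] := subsheaf_inclP s.
apply: (Gsep U W WU _ (W0 U0)); rewrite ohom_nat.
suff -> : mres (torsion F) WU s = 0 by rewrite raddf0.
by apply: (@subsheaf_incl_inj _ F); rewrite -ohom_nat raddf0.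
Qed.

Lemma torsion_free_incl_zero (F : qcoh X) :
  ohom_zero (torsion F) F -> locally_torsion_free F.
Proof.
move=> tF0; apply/generically_separatedP => U W WU s W0 sW.
have Ss : generically_zero F U s by exists W, WU.
exact: (tF0 (subsheaf_incl _) U (mk_subsheaf_sec Ss)).
Qed.

Definition torsion_class (A : qcoh X) : Prop :=
  forall B : qcoh X, locally_torsion_free B -> ohom_zero A B.

Lemma torsion_free_theory :
  torsion_theory torsion_class (@locally_torsion_free X).
Proof.
split=> [A B TA|A|A TA]; [exact: TA|by []|apply: torsion_free_incl_zero].
by apply: TA => B Btf; apply: torsion_hom_zero.
Qed.

End TorsionFree.

(** A morphism u from a torsion object to the product has the same components
    as the zero morphism, so u = 0 by uniqueness. *)
Lemma torsion_free_class_products (X : scheme) (T C : qcoh X -> Prop) :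
  torsion_theory T C -> closed_under_products C.
Proof.
move=> TC I F P p CF Pp; apply: (torsion_free_classP TC) => A TA u U s.
have [w _ wP] := Pp A (fun i => ohom_null A (F i)).
rewrite (wP u) => [|i V t]; last first.
  exact: (torsion_hom0 TC TA (CF i) (ohom_comp (p i) u)).
rewrite -(wP (ohom_null A P)) // => i V t; exact: raddf0.
Qed.

(** * Extension of sections of torsion-free sheaves *)

Section Extension.
Variables (X : scheme) (hX : integral_scheme X) (F : qcoh X).
Hypothesis Fsep : generically_separated F.
Variables (U : opens X) (c : affineChart U) (f : chart_ring c).
Variable y : F (chart_basic c f).

(** On W, the section t extends f^n y. Quantifying over all V that lie in both
    W and D(f) avoids naming their intersection. *)
Let extension (W : opens X) (WU : W `<=` U) (n : nat) (t : F W) :=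
  forall (V : opens X) (VW : V `<=` W) (VU : V `<=` U)
    (Vf : V `<=` chart_basic c f),
    mres F VW t = res VU (chart_sec c f) ^+ n *: mres F Vf y.

(** Let V be a chart on which F localizes, and D(h) a neighbourhood of x in U
    and V. There f = b / h^k, so D(h) and D(f) meet in D(h b), and (h b)^m y
    extends to V for some m; as (h b)^m = h^(m + k m) f^m on D(h), where h is
    invertible, f^m y extends to D(h). *)
Lemma extension_local x : opens_set U x -> exists2 W : opens X, opens_set W x &
  exists (WU : W `<=` U) n (t : F W), extension WU n t.
Proof.
move=> Ux; have [V [Vx [c' Fc']]] := proj1 (qcoh_localizes F) (qcohP F) x.
have [P Px] := chart_mem c' Vx.
move: (Ux); rewrite -Px => /chart_nbhs[h [Ph hU]].
pose W := chart_basic c' h; have WV : W `<=` V := chart_basicS c' h.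
exists W; first exact/chart_basicP.
exists hU; pose a := res hU (chart_sec c f).
have [[u hu] frac _] := @chart_loc _ _ c' h _ WV erefl.
have [k [b ab]] := frac a.
have hbf : chart_basic c' (h * b) `<=` chart_basic c f.
  move=> q hbq.
  have hbh : chart_basic c' (h * b) `<=` W by move=> z /chart_basicM[].
  have hbb : chart_basic c' (h * b) `<=` chart_basic c' b.
    by move=> z /chart_basicM[].
  apply: (@chart_unit_basic _ _ c f q _ (subset_trans hbh hU)) => //.
  have [v bv] := chart_unit (subset_trans hbh WV) hbb.
  move/(congr1 (res hbh)): ab.
  rewrite rmorphM /= (res_comp _ _ (subset_trans hbh WV)) /a => E.
  exists (res hbh (res WV (chart_sec c' h) ^+ k) * v).
  by rewrite mulrA -(res_comp hbh hU) [X in X * v]mulrC E.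
have [_ fracF] := Fc' (h * b); have [m [t tE]] := fracF (mres F hbf y).
exists m, (u ^+ (m + k * m) *: mres F WV t) => Z ZW ZU Zf.
have Zhb : Z `<=` chart_basic c' (h * b).
  move=> q Zq; apply/chart_basicM; split; first exact: ZW.
  apply: (@chart_unit_basic _ _ c' b q _ (subset_trans ZW WV)) => //.
  have [v fv] := chart_unit ZU Zf.
  exists (res ZW u ^+ k * v).
  rewrite -(res_comp ZW WV) -ab rmorphM rmorphXn /= mulrACA -exprMn -rmorphM hu.
  by rewrite rmorph1 expr1n mul1r (res_comp _ _ ZU) fv.
rewrite mresZ (mres_comp _ _ (subset_trans ZW WV)).
rewrite -(mres_comp Zhb (chart_basicS c' (h * b))) -tE mresZ (mres_comp _ _ Zf).
rewrite scalerA; congr (_ *: _).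
rewrite !rmorphXn /= (res_comp _ _ (subset_trans ZW WV)) rmorphM rmorphM /=.
rewrite -!(res_comp ZW WV) -ab rmorphM /= -/a (res_comp _ _ ZU) rmorphXn /=.
rewrite mulrA -exprS exprMn -exprM mulSn mulrA -exprMn -rmorphM.
by rewrite [u * _]mulrC hu rmorph1 expr1n mul1r.
Qed.

(** Both extensions are brought to the exponent n1 + n2. They then agree on the
    intersection of V1, V2 and D(f), hence on that of V1 and V2, because F is
    generically separated: this is why they glue. *)
Lemma extension_union (W V1 V2 : opens X) : chart_basic c f !=set0 ->
  W `<=` V1 `|` V2 ->
  (exists (WU : V1 `<=` U) n (t : F V1), extension WU n t) ->
  (exists (WU : V2 `<=` U) n (t : F V2), extension WU n t) ->
  exists (WU : W `<=` U) n (t : F W), extension WU n t.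
Proof.
move=> D0 cov [V1U [n1 [t1 E1]]] [V2U [n2 [t2 E2]]].
have WU : W `<=` U by move=> x /cov[/V1U|/V2U].
pose W1 := opensI W V1; pose W2 := opensI W V2.
have W1W : W1 `<=` W by exact: subIsetl.
have W2W : W2 `<=` W by exact: subIsetl.
have W1V : W1 `<=` V1 by exact: subIsetr.
have W2V : W2 `<=` V2 by exact: subIsetr.
have W1U : W1 `<=` U := subset_trans W1W WU.
have W2U : W2 `<=` U := subset_trans W2W WU.
pose s1 := res W1U (chart_sec c f) ^+ n2 *: mres F W1V t1.
pose s2 := res W2U (chart_sec c f) ^+ n1 *: mres F W2V t2.
have s1E (V : opens X) (VW : V `<=` W1) (VU : V `<=` U)
    (Vf : V `<=` chart_basic c f) :
    mres F VW s1 = res VU (chart_sec c f) ^+ (n1 + n2) *: mres F Vf y.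
  rewrite mresZ rmorphXn /= (res_comp _ _ VU).
  rewrite (mres_comp _ _ (subset_trans VW W1V)).
  by rewrite (E1 _ _ VU Vf) scalerA -exprD addnC.
have s2E (V : opens X) (VW : V `<=` W2) (VU : V `<=` U)
    (Vf : V `<=` chart_basic c f) :
    mres F VW s2 = res VU (chart_sec c f) ^+ (n1 + n2) *: mres F Vf y.
  rewrite mresZ rmorphXn /= (res_comp _ _ VU).
  rewrite (mres_comp _ _ (subset_trans VW W2V)).
  by rewrite (E2 _ _ VU Vf) scalerA -exprD.
have cov' : W `<=` W1 `|` W2 by move=> x Wx; have [] := cov x Wx; [left|right].
have [V VW1 VW2|t [ts1 ts2]] :=
  sheaf_glue2 (msec_sheaf F) W1W W2W (s1 := s1) (s2 := s2) cov'.
  have [V0|V0] := pselect (V !=set0); last first.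
    by rewrite (mres_empty (mres F VW1 s1) V0) (mres_empty (mres F VW2 s2) V0).
  pose Z := opensI V (chart_basic c f).
  have ZV : Z `<=` V by exact: subIsetl.
  have Zf : Z `<=` chart_basic c f by exact: subIsetr.
  have ZU : Z `<=` U := subset_trans Zf (chart_basicS c f).
  apply/eqP; rewrite -subr_eq0; apply/eqP.
  apply: (Fsep (WU := ZV)); first exact: irreducible hX _ _ V0 D0.
  rewrite raddfB /= (mres_comp _ _ (subset_trans ZV VW1)).
  rewrite (mres_comp _ _ (subset_trans ZV VW2)).
  by rewrite (s1E _ _ ZU Zf) (s2E _ _ ZU Zf) subrr.
exists WU, (n1 + n2)%N, t => V VW VU Vf.
apply: (sheaf_sep (msec_sheaf F)) => x Vx.
have [W1x|W2x] := cov' x (VW x Vx).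
- pose Z := opensI V W1; have ZV : Z `<=` V by exact: subIsetl.
  have ZW1 : Z `<=` W1 by exact: subIsetr.
  exists Z, ZV; split=> //.
  rewrite (mres_comp _ _ (subset_trans ZV VW)) -(mres_comp ZW1 W1W) ts1.
  rewrite (s1E _ _ (subset_trans ZV VU) (subset_trans ZV Vf)).
  by rewrite mresZ rmorphXn /= (res_comp ZV VU (subset_trans ZV VU))
             (mres_comp _ _ (subset_trans ZV Vf)).
- pose Z := opensI V W2; have ZV : Z `<=` V by exact: subIsetl.
  have ZW2 : Z `<=` W2 by exact: subIsetr.
  exists Z, ZV; split=> //.
  rewrite (mres_comp _ _ (subset_trans ZV VW)) -(mres_comp ZW2 W2W) ts2.
  rewrite (s2E _ _ (subset_trans ZV VU) (subset_trans ZV Vf)).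
  by rewrite mresZ rmorphXn /= (res_comp ZV VU (subset_trans ZV VU))
             (mres_comp _ _ (subset_trans ZV Vf)).
Qed.

(** The extensions exist locally on U and can be combined over unions, so the
    quasi-compactness of U gives one over U. *)
Lemma sections_extend : exists n (x : F U),
  res (chart_basicS c f) (chart_sec c f) ^+ n *: y = mres F (chart_basicS c f) x.
Proof.
have [D0|D0] := pselect (chart_basic c f !=set0); last first.
  by exists 0%N, 0; rewrite raddf0 (mres_empty y D0) scaler0.
have [] := @affine_open_ind _ _ c
  (fun W => exists (WU : W `<=` U) n (t : F W), extension WU n t).
- move=> W W0; have WU : W `<=` U by move=> x Wx; case: W0; exists x.
  exists WU, 0%N, 0 => V VW VU Vf.
  have V0 : ~ (V !=set0) by move=> [x /VW Wx]; apply: W0; exists x.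
  by rewrite (mres_empty (mres F VW 0) V0) (mres_empty (mres F Vf y) V0) scaler0.
- by move=> W V1 V2; apply: extension_union.
- exact: extension_local.
move=> UU [n [t tE]]; exists n, t.
by rewrite (tE _ _ (chart_basicS c f) (@subset_refl _ _)) mres_id.
Qed.

End Extension.

(** * Sections of a direct limit come locally from the system *)

Section LocalImage.
Variables (X : scheme) (hX : integral_scheme X).
Variables (I : Type) (le : I -> I -> Prop) (F : I -> qcoh X).
Variables (f : forall i j, le i j -> ohom (F i) (F j)).
Variables (L : qcoh X) (l : forall i, ohom (F i) L).
Hypotheses (le_dir : directed_preorder le) (f_l : is_cocone (@f) l).
Arguments f {i j}.

Definition locally_in_image (U : opens X) : set (L U) := [set s |
  forall x, opens_set U x -> exists (W : opens X) (WU : W `<=` U) i (y : F i W),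
    opens_set W x /\ mres L WU s = l i W y].

Lemma image_locally_in_image (U : opens X) i (y : F i U) :
  locally_in_image (l i U y).
Proof. by move=> x Ux; exists U, (@subset_refl _ _), i, y; rewrite mres_id. Qed.

Lemma locally_in_image0 (U : opens X) : locally_in_image (0 : L U).
Proof.
have [i] := directed_inhabited le_dir.
by rewrite -(raddf0 (l i U)); exact: image_locally_in_image.
Qed.

(** Two indices i and j are reconciled at a common upper bound k. *)
Lemma locally_in_imageZD (U : opens X) (a : sec U) (s t : L U) :
  locally_in_image s -> locally_in_image t -> locally_in_image (a *: s + t).
Proof.
move=> Ss St x Ux.
have [W1 [W1U [i [y [W1x sE]]]]] := Ss x Ux.
have [W2 [W2U [j [z [W2x tE]]]]] := St x Ux.
have [k ik jk] := directed_ub le_dir i j; pose W := opensI W1 W2.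
have WW1 : W `<=` W1 by exact: subIsetl.
have WW2 : W `<=` W2 by exact: subIsetr.
have WU := subset_trans WW1 W1U.
exists W, WU, k,
  (res WU a *: f ik W (mres (F i) WW1 y) + f jk W (mres (F j) WW2 z)).
split=> //; rewrite !raddfD /= mresZ linearZ /= !f_l.
by rewrite -!ohom_nat -sE -tE (mres_comp _ _ WU) (mres_comp _ _ WU).
Qed.

Lemma locally_in_image_res (U V : opens X) (UV : U `<=` V) (s : L V) :
  locally_in_image s -> locally_in_image (mres L UV s).
Proof.
move=> Ss x Ux; have [W [WV [i [y [Wx sE]]]]] := Ss x (UV x Ux).
pose Z := opensI W U; have ZW : Z `<=` W by exact: subIsetl.
have ZU : Z `<=` U by exact: subIsetr.
have ZV := subset_trans ZU UV.
exists Z, ZU, i, (mres (F i) ZW y); split=> //.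
by rewrite -ohom_nat -sE (mres_comp _ _ ZV) (mres_comp _ _ ZV).
Qed.

Lemma locally_in_image_local (U : opens X) (s : L U) :
  (forall x, opens_set U x -> exists (W : opens X) (WU : W `<=` U),
    opens_set W x /\ locally_in_image (mres L WU s)) -> locally_in_image s.
Proof.
move=> loc x Ux; have [V [VU [Vx Ss]]] := loc x Ux.
have [W [WV [i [y [Wx sE]]]]] := Ss x Vx.
by exists W, (subset_trans WV VU), i, y; rewrite -(mres_comp WV VU).
Qed.

Definition local_image : subsheaf L :=
  Subsheaf locally_in_image0 locally_in_imageZD locally_in_image_res
    locally_in_image_local.

Hypothesis F_sep : forall i, generically_separated (F i).

(** Let s be a section over D(h) that comes locally from the system. The a such
    that a s is the restriction of some l_i(z), with z a section over the whole
    of U, form an ideal J. At a point of D(h), s = l_i(y) on some D(g), and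
    g^n y extends to z over U by [sections_extend]. The difference l_i(z) - g^n s
    vanishes on D(g), so it is killed by g^m on D(h), and g^(m + n) is in J.
    Thus no prime in D(h) contains J, and some h^n lies in J. *)
Lemma local_image_qcoh : quasi_coherent (subsheaf_omodule local_image).
Proof.
have [i0] := directed_inhabited le_dir; have ub := directed_ub le_dir.
apply/qcoh_localizes => x.
have [U [Ux [c Lc]]] := proj1 (qcoh_localizes L) (qcohP L) x.
exists U; split=> //; exists c; apply: subsheaf_localizes => // h s Ss.
pose D := chart_basic c h; pose DU : D `<=` U := chart_basicS c h.
pose J := [set a | exists i (z : F i U),
  res DU (chart_sec c a) *: s = mres L DU (l i U z)].
have Jid : ideal J.
  split.
  - by exists i0, 0; rewrite !raddf0 scale0r.
  - move=> a b [i [y yE]] [j [z zE]]; have [k ik jk] := ub i j.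
    exists k, (f ik U y + f jk U z).
    by rewrite !raddfD /= scalerDl yE zE !f_l.
  - move=> a b [i [z zE]]; exists i, (chart_sec c a *: z).
    by rewrite !rmorphM /= linearZ /= mresZ -scalerA zE.
have [[n [i [z zE]]]|nJ] := pselect (exists n, J (h ^+ n)).
  exists n, (l i U z); split; last by rewrite -zE !rmorphXn.
  exact: image_locally_in_image.
have [|P [JP Ph]] := prime_avoiding (f := h) Jid.
  by move=> n Jn; apply: nJ; exists n.
have [|W [WD [i [y [WP sE]]]]] := Ss (chart_pt c P); first exact/chart_basicP.
have [g [Pg gW]] := chart_nbhs WP.
have [n [z zE]] := sections_extend hX (@F_sep i) (mres (F i) gW y).
have gD : chart_basic c g `<=` D := subset_trans gW WD.
have [|m tE] := localizes_on_basic (gf := gD)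
  (t := mres L DU (l i U z) - res DU (chart_sec c g) ^+ n *: s) Lc.
  rewrite raddfB /= mresZ rmorphXn /= (res_comp _ _ (chart_basicS c g)).
  rewrite (mres_comp _ _ (chart_basicS c g)) ohom_nat -zE linearZ /=.
  by rewrite -ohom_nat -sE (mres_comp _ _ gD) subrr.
case: Pg; apply: (prime_ideal_exp (n := m + n) (spec_prime P)); apply: JP.
exists i, (chart_sec c g ^+ m *: z).
rewrite linearZ /= mresZ; move/eqP: tE; rewrite scalerBr subr_eq0 => /eqP tE.
by rewrite !rmorphXn /= tE scalerA exprD.
Qed.

Definition local_image_sheaf : qcoh X := QCoh local_image_qcoh.

Hypothesis L_lim : is_direct_limit (@f) l.

(** The maps l_i factor through the subsheaf of locally-in-image sections. The
    resulting map u from L to this subsheaf, followed by the inclusion, is an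
    endomorphism of L compatible with the l_i, hence the identity. *)
Lemma direct_limit_local (U : opens X) (s : L U) : locally_in_image s.
Proof.
have [_ univ] := L_lim.
have [|u uE _] := univ local_image_sheaf
  (fun i => @subsheaf_factor _ _ local_image _ (l i)
    (fun V => @image_locally_in_image V i)).
  by move=> i j ij V y; apply: (@subsheaf_incl_inj _ L); exact: f_l.
have [w _ wP] := univ L l f_l.
have -> : s = ohom_comp (subsheaf_incl local_image) u U s; last first.
  exact: (subsheaf_inclP (S := local_image)).
rewrite (wP (ohom_comp (subsheaf_incl local_image) u)) => [|i V y].
  by rewrite -(wP (ohom_id L)).
by rewrite /= uE.
Qed.

End LocalImage.

(** * Reduced products of abelian groups *)

Section ZmodProduct.
Variables (J : Type) (M : J -> zmodType).

Definition zprod : Type := forall j, M j.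

HB.instance Definition _ := gen_eqMixin zprod.
HB.instance Definition _ := gen_choiceMixin zprod.

Let zprod_add (s t : zprod) : zprod := fun j => s j + t j.
Let zprod_opp (s : zprod) : zprod := fun j => - s j.
Let zprod_zero : zprod := fun=> 0.

Lemma eq_zprod (s t : zprod) : (forall j, s j = t j) -> s = t.
Proof. exact: functional_extensionality_dep. Qed.

Let zprod_addA : associative zprod_add.
Proof. by move=> s t u; apply: eq_zprod => j; exact: addrA. Qed.
Let zprod_addC : commutative zprod_add.
Proof. by move=> s t; apply: eq_zprod => j; exact: addrC. Qed.
Let zprod_add0 : left_id zprod_zero zprod_add.
Proof. by move=> s; apply: eq_zprod => j; exact: add0r. Qed.
Let zprod_addN : left_inverse zprod_zero zprod_opp zprod_add.
Proof. by move=> s; apply: eq_zprod => j; exact: addNr. Qed.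

HB.instance Definition _ := GRing.isZmodule.Build zprod
  zprod_addA zprod_addC zprod_add0 zprod_addN.

Lemma zprodDE (s t : zprod) j : (s + t) j = s j + t j. Proof. by []. Qed.
Lemma zprodNE (s : zprod) j : (- s) j = - s j. Proof. by []. Qed.

End ZmodProduct.

(** A reduced product is used in place of the quotient that defines a direct
    limit of modules: an element of the i-th module, extended by its images at
    the later indices and by 0 elsewhere, becomes a family, defined up to
    eventual equality. The direct limit embeds in the reduced product, which
    is all that is needed, and the operations are pointwise. *)
Section ReducedProduct.
Variables (J : Type) (M : J -> zmodType) (Fl : set_system J) (FF : Filter Fl).

Definition eventually_zero of Filter Fl : pred (zprod M) :=
  fun s => `[< Fl [set j | s j = 0] >].

Let eventually_zero_closed : zmod_closed (eventually_zero FF).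
Proof.
split=> [|s t /asboolP s0 /asboolP t0]; apply: asboolT.
  by apply: filterS filterT.
apply: filterS (filterI s0 t0) => j [/= sj tj].
by rewrite zprodDE zprodNE sj tj subrr.
Qed.

HB.instance Definition _ :=
  GRing.isZmodClosed.Build (zprod M) (eventually_zero FF) eventually_zero_closed.

Definition eventually_zero_zmod : zmodClosed (zprod M) :=
  GRing.ZmodClosed.clone _ (eventually_zero FF) _.

Definition reduced_product : zmodType := Quotient.quot eventually_zero_zmod.

Definition rclass (s : zprod M) : reduced_product :=
  (\pi_(Quotient.quot eventually_zero_zmod) s)%qT.

Lemma rclassP (s t : zprod M) :
  rclass s = rclass t <-> Fl [set j | s j = t j].
Proof.
have -> : [set j | s j = t j] = [set j | (s - t) j = 0].
  apply/seteqP; split=> j /= st; first by rewrite zprodDE zprodNE st subrr.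
  by apply/eqP; rewrite -subr_eq0; apply/eqP.
split=> [/eqP|st]; first by rewrite -Quotient.idealrBE => /asboolP.
by apply/eqP; rewrite -Quotient.idealrBE; exact: asboolT.
Qed.

Lemma rclassD (s t : zprod M) : rclass (s + t) = rclass s + rclass t.
Proof. exact: raddfD. Qed.

Lemma rclass0 : rclass 0 = 0.
Proof. exact: raddf0. Qed.

Lemma rclass_surj (v : reduced_product) : exists s, rclass s = v.
Proof. by exists (repr v); exact: reprK. Qed.

(** The map induced by phi on classes, provided that phi respects eventual
    equality; see [rlift_class]. *)
Definition rlift (phi : zprod M -> zprod M) (v : reduced_product) :
  reduced_product := rclass (phi (repr v)).

Lemma rlift_class (phi : zprod M -> zprod M) (s : zprod M) :
  (forall t u, Fl [set j | t j = u j] -> Fl [set j | phi t j = phi u j]) ->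
  rlift phi (rclass s) = rclass (phi s).
Proof. by move=> phiF; apply/rclassP/phiF/rclassP; exact: reprK. Qed.

End ReducedProduct.

(** * The constant sheaf of germs of a direct system *)

Section ConstantSheaf.
Variables (X : scheme) (hX : integral_scheme X).
Variables (I : Type) (le : I -> I -> Prop) (F : I -> qcoh X).
Hypothesis le_dir : directed_preorder le.

(** The filter of sets of pairs (j, V) that contain all pairs with j large and V
    small but nonempty. It is a filter because the index set is directed and X
    is irreducible; small nonempty V are the neighbourhoods of the generic
    point. *)
Definition tails : set_system (I * opens X) := [set A |
  exists i (W : opens X), W !=set0 /\ forall j (V : opens X),
    le i j -> V `<=` W -> V !=set0 -> A (j, V)].

Lemma tails_filter : Filter tails.
Proof.
split.
- have [i] := directed_inhabited le_dir; have [X0 _] := hX.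
  by exists i, (Opens openT).
- move=> A B [i [W [W0 A_]]] [j [V [V0 B_]]].
  have [k ik jk] := directed_ub le_dir i j.
  exists k, (opensI W V); split=> [|m Z km ZWV Z0].
    exact: irreducible hX _ _ W0 V0.
  split; [apply: A_|apply: B_] => //.
  + exact: (directed_trans le_dir ik km).
  + by move=> x /ZWV[].
  + exact: (directed_trans le_dir jk km).
  + by move=> x /ZWV[].
- move=> A B AB [i [W [W0 A_]]]; exists i, W; split=> // j V ij VW V0.
  exact/AB/A_.
Qed.

Local Notation sections := (fun j : I * opens X => F j.1 j.2 : zmodType).
Local Notation family := (zprod sections).
Definition germs : zmodType := reduced_product sections tails_filter.
Local Notation germ := (@rclass _ sections _ tails_filter).

(** A function on U acts only on the sections over subsets of U. The value 0
    elsewhere makes the unit law fail for families; it holds for their classes,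
    as long as U is nonempty. *)
Definition family_scale (U : opens X) (a : sec U) (s : family) : family :=
  fun j => if pselect (j.2 `<=` U) is left jU then res jU a *: s j else 0.

Definition germ_scale (U : opens X) (a : sec U) (v : germs) : germs :=
  rlift (family_scale a) v.

Lemma germ_scaleE (U : opens X) (a : sec U) (s : family) :
  germ_scale a (germ s) = germ (family_scale a s).
Proof.
apply: rlift_class => t u; apply: (@filterS _ _ tails_filter) => j /= tu.
by rewrite /family_scale; case: pselect => // jU; rewrite tu.
Qed.

Lemma tails_sub (U : opens X) (A : set (I * opens X)) : U !=set0 ->
  (forall j : I * opens X, j.2 `<=` U -> A j) -> tails A.
Proof.
move=> U0 AU; have [i] := directed_inhabited le_dir.
by exists i, U; split=> // j V _ VU _; apply: AU.
Qed.

Lemma germ_scaleA (U : opens X) (a b : sec U) v :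
  germ_scale a (germ_scale b v) = germ_scale (a * b) v.
Proof.
have [s <-] := rclass_surj v; rewrite !germ_scaleE; congr (germ _).
apply: eq_zprod => j; rewrite /family_scale; case: pselect => // jU.
by rewrite rmorphM scalerA.
Qed.

Lemma germ_scale1 (U : opens X) v : U !=set0 -> germ_scale (1 : sec U) v = v.
Proof.
move=> U0; have [s <-] := rclass_surj v; rewrite germ_scaleE; apply/rclassP.
apply: (tails_sub U0) => j jU; rewrite /= /family_scale.
by case: pselect => // jU'; rewrite rmorph1 scale1r.
Qed.

Lemma germ_scaleDr (U : opens X) (a : sec U) u v :
  germ_scale a (u + v) = germ_scale a u + germ_scale a v.
Proof.
have [s <-] := rclass_surj u; have [t <-] := rclass_surj v.
rewrite -rclassD !germ_scaleE -rclassD; congr (germ _).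
apply: eq_zprod => j; rewrite zprodDE /family_scale.
by case: pselect => [jU|_]; rewrite ?addr0 // zprodDE scalerDr.
Qed.

Lemma germ_scaleDl (U : opens X) (a b : sec U) v :
  germ_scale (a + b) v = germ_scale a v + germ_scale b v.
Proof.
have [s <-] := rclass_surj v; rewrite !germ_scaleE -rclassD; congr (germ _).
apply: eq_zprod => j; rewrite zprodDE /family_scale.
by case: pselect => [jU|_]; rewrite ?addr0 // rmorphD scalerDl.
Qed.

Lemma germ_scale_res (U V : opens X) (UV : U `<=` V) (a : sec V) v :
  U !=set0 -> germ_scale (res UV a) v = germ_scale a v.
Proof.
move=> U0; have [s <-] := rclass_surj v; rewrite !germ_scaleE; apply/rclassP.
apply: (tails_sub U0) => j jU; rewrite /= /family_scale.
case: pselect => // jU'; case: pselect => [jV|]; last first.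
  by case; apply: subset_trans UV.
by rewrite (res_comp _ _ jV).
Qed.

(** The constant sheaf with value the group of germs. Functions on the
    proposition that U is nonempty give both cases at once: all germs if U is
    nonempty, and the trivial group otherwise. *)
Definition const_sec (U : opens X) : Type := zprod (fun _ : U !=set0 => germs).

HB.instance Definition _ (U : opens X) := GRing.Zmodule.on (const_sec U).

Section ConstModule.
Variable U : opens X.

Let scale (a : sec U) (g : const_sec U) : const_sec U :=
  fun h => germ_scale a (g h).

Let scaleA a b g : scale a (scale b g) = scale (a * b) g.
Proof. by apply: eq_zprod => h; exact: germ_scaleA. Qed.
Let scale1 : left_id 1 scale.
Proof. by move=> g; apply: eq_zprod => h; exact: germ_scale1. Qed.
Let scaleDr : right_distributive scale +%R.
Proof. by move=> a g g'; apply: eq_zprod => h; exact: germ_scaleDr. Qed.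
Let scaleDl g : {morph scale^~ g : a b / a + b}.
Proof. by move=> a b; apply: eq_zprod => h; exact: germ_scaleDl. Qed.

HB.instance Definition _ := GRing.Zmodule_isLmodule.Build (sec U) (const_sec U)
  scaleA scale1 scaleDr scaleDl.

End ConstModule.

Lemma nonempty_sub (U V : opens X) : U `<=` V -> U !=set0 -> V !=set0.
Proof. by move=> UV [x /UV Vx]; exists x. Qed.

Definition const_res (U V : opens X) (UV : U `<=` V) (g : const_sec V) :
  const_sec U := fun h => g (nonempty_sub UV h).

Let const_resL (U V : opens X) (UV : U `<=` V) :
  linear_for (res UV \; *:%R) (const_res UV).
Proof.
move=> a g g'; apply: eq_zprod => h.
by congr (_ + _); apply/esym; exact: germ_scale_res.
Qed.

HB.instance Definition _ (U V : opens X) (UV : U `<=` V) :=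
  GRing.isLinear.Build (sec V) (const_sec V) (const_sec U) (res UV \; *:%R)
    (const_res UV) (const_resL UV).

Lemma const_irrelevance (U : opens X) (g : const_sec U) h h' : g h = g h'.
Proof. by congr (g _); exact: Prop_irrelevance. Qed.

(** Compatible sections over a cover all have the same value, since nonempty
    members of the cover meet. *)
Lemma const_is_sheaf : @is_sheaf X const_sec const_res.
Proof.
split.
- by move=> U UU g; apply: eq_zprod => h; exact: (const_irrelevance g).
- by move=> U V W UV VW UW g; apply: eq_zprod => h; exact: (const_irrelevance g).
- move=> J V U UV cov s ss.
  have agree i j (hi : U i !=set0) (hj : U j !=set0) : s i hi = s j hj.
    have hij := irreducible hX hi hj.
    move/(congr1 (fun g : const_sec (opensI (U i) (U j)) => g hij)): (ss i j).
    rewrite /const_res (const_irrelevance (s i) _ hi).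
    by rewrite (const_irrelevance (s j) _ hj).
  have idx (h : V !=set0) : {i | U i !=set0}.
    by apply: cid; have [x Vx] := h; have [i _ Ux] := cov x Vx; exists i, x.
  pose t : const_sec V := fun h => let: exist i hi := idx h in s i hi.
  have tE i (hi : U i !=set0) (h : V !=set0) : t h = s i hi.
    by rewrite /t; case: (idx h) => j hj; exact: agree.
  exists t; split=> [i|t' t'E]; apply: eq_zprod => h; first exact: tE.
  have [x Vx] := h; have [i _ Ux] := cov x Vx.
  have hi : U i !=set0 by exists x.
  by rewrite (tE i hi) -t'E; exact: (const_irrelevance t').
Qed.

Definition const_omodule : omodule X :=
  @OModule X (fun U => [the lmodType _ of const_sec U])
    (fun (U V : opens X) (UV : U `<=` V) =>
      [the {linear _ -> _ | _} of const_res UV])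
    const_is_sheaf.

(** Restriction to a nonempty D(f) is bijective; in a nonempty chart, D(f) is
    empty only if f = 0. *)
Lemma const_qcoh : quasi_coherent const_omodule.
Proof.
apply/qcoh_localizes => x; have [U Ux [c]] := scheme_affine x.
exists U; split=> //; exists c => f; split=> [g gf|g].
  have U0 : U !=set0 by exists x.
  have [f0|f0] := pselect (f = 0).
    by exists 1%N; rewrite f0 rmorph0 expr1 scale0r.
  have D0 := chart_basic_nonempty hX U0 f0.
  exists 0%N; rewrite expr0 scale1r; apply: eq_zprod => h.
  have gD0 := congr1 (fun k : const_sec (chart_basic c f) => k D0) gf.
  by rewrite -[RHS]gD0; exact: (const_irrelevance (g : const_sec U)).
have [D0|D0] := pselect (chart_basic c f !=set0); last first.
  by exists 0%N, 0; rewrite raddf0 (mres_empty g D0) scaler0.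
exists 0%N, ((fun=> g D0) : const_sec U); rewrite expr0 scale1r.
by apply: eq_zprod => h; exact: (const_irrelevance (g : const_sec _)).
Qed.

Definition const_sheaf : qcoh X := QCoh const_qcoh.

Section GermMap.
Variable f : forall i j, le i j -> ohom (F i) (F j).
Variable i : I.

(** The family of all images of s at later indices, over smaller open sets. *)
Definition to_family (U : opens X) (s : F i U) : family := fun j =>
  match pselect (le i j.1), pselect (j.2 `<=` U) with
  | left ij, left jU => mres (F j.1) jU (f ij U s)
  | _, _ => 0
  end.

Lemma to_familyE (U : opens X) (s : F i U) j (V : opens X)
    (ij : le i j) (VU : V `<=` U) :
  to_family s (j, V) = mres (F j) VU (f ij U s).
Proof.
rewrite /to_family /=; case: pselect => // ij'; case: pselect => // VU'.
by rewrite (Prop_irrelevance ij' ij) (Prop_irrelevance VU' VU).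
Qed.

Definition germ_map_fun (U : opens X) (s : F i U) : const_sec U :=
  fun=> germ (to_family s).

Let germ_map_linear (U : opens X) : linear (@germ_map_fun U).
Proof.
move=> a s t; apply: eq_zprod => h.
change (germ (to_family (a *: s + t)) =
  germ_scale a (germ (to_family s)) + germ (to_family t)).
rewrite germ_scaleE -rclassD; congr (germ _).
apply: eq_zprod => -[j V]; rewrite zprodDE /family_scale /to_family /=.
case: pselect => ij; last by case: pselect => VU; rewrite ?scaler0 ?addr0.
by case: pselect => VU; rewrite ?addr0 // !linearP.
Qed.

HB.instance Definition _ (U : opens X) :=
  GRing.isLinear.Build (sec U) (F i U) (const_sec U) *:%R
    (@germ_map_fun U) (@germ_map_linear U).

Lemma germ_map_nat (U V : opens X) (UV : U `<=` V) (s : F i V) :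
  const_res UV (germ_map_fun s) = germ_map_fun (mres (F i) UV s).
Proof.
apply: eq_zprod => h; apply/rclassP; exists i, U; split=> // j W ij WU W0 /=.
rewrite (to_familyE _ ij WU) (to_familyE _ ij (subset_trans WU UV)).
by rewrite -ohom_nat (mres_comp _ _ (subset_trans WU UV)).
Qed.

Definition germ_map : ohom (F i) const_sheaf :=
  @OHom X (F i) const_sheaf (fun U => [the {linear _ -> _} of @germ_map_fun U])
    germ_map_nat.

(** The germ of s is zero only if s already dies at a finite stage of the
    system and generically on U. *)
Lemma germ_map_eq0 (U : opens X) (s : F i U) : U !=set0 -> germ_map U s = 0 ->
  exists j (ij : le i j) (W : opens X) (WU : W `<=` U),
    W !=set0 /\ mres (F j) WU (f ij U s) = 0.
Proof.
move=> U0 /(congr1 (fun g : const_sec U => g U0)).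
rewrite -[RHS]/(0 : germs) -rclass0 => /rclassP[j0 [W [W0 s0]]].
have [k ik jk] := directed_ub le_dir i j0.
exists k, ik, (opensI W U), (@subIsetr _ _ _).
have WU0 := irreducible hX W0 U0; split=> //.
by rewrite -(to_familyE s ik) s0 //; exact: subIsetl.
Qed.

End GermMap.

Lemma germ_map_cocone (f : forall i j, le i j -> ohom (F i) (F j)) :
  is_direct_system f -> is_cocone f (germ_map f).
Proof.
move=> f_sys i j ij U s; apply: eq_zprod => h; apply/rclassP.
exists j, U; split=> // k V jk VU V0 /=.
have ik := directed_trans le_dir ij jk.
rewrite (to_familyE f _ jk VU) (to_familyE f _ ik VU).
by rewrite (direct_system_comp f_sys).
Qed.

End ConstantSheaf.

(** * Direct limits of torsion-free sheaves *)

(** The two facts about L combine: s is locally l_i(y), and as s vanishes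
    generically, so does some f_ij(y), which is then zero in F_j. *)
Lemma direct_limit_separated (X : scheme) (hX : integral_scheme X)
    (I : Type) (le : I -> I -> Prop) (F : I -> qcoh X)
    (f : forall i j, le i j -> ohom (F i) (F j))
    (L : qcoh X) (l : forall i, ohom (F i) L) :
  directed_preorder le -> is_direct_system f ->
  (forall i, generically_separated (F i)) -> is_direct_limit f l ->
  generically_separated L.
Proof.
move=> le_dir f_sys F_sep L_lim U W WU s W0 sW.
have [f_l univ] := L_lim.
have [u uE _] := univ _ _ (germ_map_cocone hX le_dir f_sys).
apply: mres_eq0 => x Ux.
have [V [VU [i [y [Vx sE]]]]] :=
  direct_limit_local hX le_dir f_l F_sep L_lim s Ux.
exists V, VU; split=> //; rewrite sE.
have V0 : V !=set0 by exists x.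
pose Z := opensI V W; have Z0 : Z !=set0 := irreducible hX V0 W0.
have ZV : Z `<=` V by exact: subIsetl.
have ZW : Z `<=` W by exact: subIsetr.
have lyZ : l i Z (mres (F i) ZV y) = 0.
  rewrite -ohom_nat -sE (mres_comp _ _ (subset_trans ZV VU)).
  by rewrite -(mres_comp ZW WU) sW raddf0.
have [|j [ij [T [TZ [T0 yT]]]]] :=
  @germ_map_eq0 _ hX _ _ _ le_dir f i _ (mres (F i) ZV y) Z0.
  by rewrite -uE lyZ raddf0.
rewrite -(f_l i j ij); suff -> : f i j ij V y = 0 by rewrite raddf0.
apply: (F_sep j V T (subset_trans TZ ZV) _ T0).
by rewrite -(mres_comp TZ ZV) ohom_nat.
Qed.

Theorem corollary3p7 (X : scheme) (hX : integral_scheme X) :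
  closed_under_products (@locally_torsion_free X) /\
  exists T : qcoh X -> Prop,
    torsion_theory_of_finite_type T (@locally_torsion_free X).
Proof.
have theory := torsion_free_theory hX.
split; first exact: torsion_free_class_products theory.
exists (@torsion_class X); split=> // I le F f L l le_dir f_sys F_tf L_lim.
apply/(generically_separatedP hX).
by apply: direct_limit_separated L_lim => // i; exact/(generically_separatedP hX).
Qed.
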